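(* Let $T\in{\rm Aut}(X,\mathcal B,\mu)$ be ergodic. The following are equivalent: (i) $T$ is weakly mixing; (ii) the topological lens $\widetilde T$ on $C_2(\mu)$ is topologically transitive; (iii) $\widetilde T$ is topologically weakly mixing.
   Context: $(X,\mathcal B,\mu)$ standard probability space. $C_2(\mu)$: probability measures on $X\times X$ with both marginals $\mu$, with the compact metrizable topology $\rho_n\to\rho$ iff $\rho_n(A\times B)\to\rho(A\times B)$ for all measurable $A,B$. Topological lens: $\widetilde T(\rho)(A\times B)=\rho(T^{-1}A\times T^{-1}B)$. A homeomorphism $R$ of a compact space $Z$ is topologically transitive if for all nonempty open $U,V$ there is $n$ with $R^{-n}U\cap V\ne\emptyset$; topologically weakly mixing if $R\times R$ is topologically transitive on $Z\times Z$. *)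

(* Defs.v *)
From HB Require Import structures.
From mathcomp Require Import all_boot all_order all_algebra.
From mathcomp Require Import all_classical all_reals all_analysis.
Set Implicit Arguments. Unset Strict Implicit. Unset Printing Implicit Defensive.
Import Order.TTheory GRing.Theory Num.Theory.
Local Open Scope classical_set_scope.
Local Open Scope ring_scope.

Section defs.
Context (d : measure_display) (X : measurableType d) (R : realType).

Definition standard_borel : Prop :=
  exists f : X -> R, [/\ injective f, measurable_fun setT f,
     measurable (range f) & forall A, measurable A -> measurable (f @` A)].

Definition is_aut (mu : probability X R) (T : X -> X) : Prop :=
  exists Tinv : X -> X, [/\ cancel T Tinv, cancel Tinv T,
     measurable_fun setT T, measurable_fun setT Tinv &
     forall A, measurable A -> mu (T @^-1` A) = mu A].

Definition ergodic (mu : probability X R) (T : X -> X) : Prop :=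
  forall A, measurable A -> T @^-1` A = A -> (mu A = 0%E \/ mu A = 1%E).

Definition weakly_mixing (mu : probability X R) (T : X -> X) : Prop :=
  forall A B, measurable A -> measurable B ->
    ((fun N : nat => N.+1%:R^-1 * \sum_(n < N.+1)
        `| fine (mu ((iter n T) @^-1` A `&` B)) - fine (mu A) * fine (mu B) |) : R^nat)
      @ \oo --> 0.

Definition is_coupling (mu : probability X R) (rho : set (X * X) -> \bar R) : Prop :=
  [/\ rho set0 = 0%E, (forall E, measurable E -> (0 <= rho E)%E),
      semi_sigma_additive rho,
      rho setT = 1%E &
      forall A, measurable A -> rho (A `*` setT) = mu A /\ rho (setT `*` A) = mu A].

Definition C2 (mu : probability X R) : set (set (X * X) -> \bar R) :=
  [set rho | is_coupling mu rho].

Definition rect_nbhd (rho : set (X * X) -> \bar R) (F : seq (set X * set X)) (eps : R)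
  : set (set (X * X) -> \bar R) :=
  [set s | forall AB, AB \in F ->
     `| fine (s (AB.1 `*` AB.2)) - fine (rho (AB.1 `*` AB.2)) | < eps].

(* open subsets of C_2(mu) for the topology in which rho_n -> rho iff
   rho_n(A x B) -> rho(A x B) for all measurable A, B
   (initial topology of the maps rho |-> rho(A x B)) *)
Definition C2_open (mu : probability X R) (U : set (set (X * X) -> \bar R)) : Prop :=
  U `<=` C2 mu /\
  forall rho, U rho -> exists F : seq (set X * set X), exists2 eps : R, 0 < eps &
     (forall AB, AB \in F -> measurable AB.1 /\ measurable AB.2) /\
     C2 mu `&` rect_nbhd rho F eps `<=` U.

Definition lens (T : X -> X) (rho : set (X * X) -> \bar R) : set (X * X) -> \bar R :=
  pushforward rho (fun p : X * X => (T p.1, T p.2)).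

End defs.

Definition prod_open (Z : Type) (op : set Z -> Prop) (W : set (Z * Z)) : Prop :=
  forall z, W z -> exists U1 U2, [/\ op U1, op U2, U1 z.1, U2 z.2 &
     U1 `*` U2 `<=` W].

Definition top_transitive (Z : Type) (op : set Z -> Prop) (f : Z -> Z) : Prop :=
  forall U V, op U -> op V -> U !=set0 -> V !=set0 ->
    exists n : nat, exists2 z, V z & U (iter n f z).

Definition top_weakly_mixing (Z : Type) (op : set Z -> Prop) (f : Z -> Z) : Prop :=
  top_transitive (prod_open op) (fun p : Z * Z => (f p.1, f p.2)).

(* Main.v *)
Require Import Defs.
From HB Require Import structures.
From mathcomp Require Import all_boot all_order all_algebra.
From mathcomp Require Import all_classical all_reals all_analysis.
From mathcomp Require Import ring lra.

(** Weak mixing implies topological weak mixing: on the atoms [P_i] of a finite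
partition, weak mixing gives a time [n] with [mu (P_i & T^-n P_k) >=
(1 - dl) mu P_i mu P_k] for all [i], [k]. The excess [e_ik] then has marginals
[dl mu P_i], [dl mu P_k], so that the weights
[(1 - dl) s_ij r_kl + e_ik e_jl / dl] define a coupling [z] which is
[(1 - dl) s + dl (mu x mu)] on the partition and whose [n]-th image is
[(1 - dl) r + dl (mu x mu)] on it.

Transitivity implies weak mixing: let [f_k] be the centered indicator of
[T^-k A] and consider the averages of the kernels [f_k (x) f_k] along finite
lists of times. If their [L^2] norms have infimum [0], Bessel's inequality bounds
the Cesaro means of [<f_n, 1_B>^2]. Otherwise an almost minimal average [w] is
almost invariant, uniformly in time, by the parallelogram law. Then
[rho |-> int <w(x, .), w(y, .)> d rho(x, y)] is continuous on couplings, almost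
constant along orbits of the lens, equal to [|w|^2] on the diagonal coupling and
to [0] on [mu x mu], which contradicts transitivity. All integrals involved are
finite sums over the partition generated by finitely many [T^-k A]. *)

Set Implicit Arguments. Unset Strict Implicit. Unset Printing Implicit Defensive.
Import Order.TTheory GRing.Theory Num.Theory.
Import numFieldNormedType.Exports.
Local Open Scope classical_set_scope.
Local Open Scope ring_scope.

(** * Finitely additive set functions on finite measurable partitions *)

Definition finitely_additive (d : measure_display) (Y : measurableType d)
    (R : realType) (nu : set Y -> R) : Prop :=
  forall A B, measurable A -> measurable B -> A `&` B = set0 ->
    nu (A `|` B) = nu A + nu B.

Section fibers.
Context (d : measure_display) (Y : measurableType d) (R : realType).
Context (J : finType) (g : Y -> J).
Hypothesis mg : forall j, measurable (g @^-1` [set j]).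

Lemma measurable_fibers (P : pred J) : measurable [set y | P (g y)].
Proof.
have -> : [set y | P (g y)] = \bigcup_(j in [set j | P j]) (g @^-1` [set j]).
  apply/seteqP; split => [y Py|y [j Pj /= gy]]; by [exists (g y)|rewrite /= gy].
by apply: fin_bigcup_measurable => //; exact: finite_finset.
Qed.

(** Finite additivity is all that is used, so the same lemma serves [mu] on [X] and every coupling
    on [X * X], once [fine] is applied. *)
Lemma sum_fibers (nu : set Y -> R) (B : set Y) :
  finitely_additive nu -> measurable B ->
  nu B = \sum_j nu (B `&` g @^-1` [set j]).
Proof.
move=> nuD mB.
have nu0 : nu set0 = 0.
  have := nuD set0 set0 measurable0 measurable0 (setI0 _).
  by rewrite setU0 => /eqP; rewrite -subr_eq subrr eq_sym => /eqP.
(* Induction on duplicate-free lists of indices: [uniq] makes the fiber of the head disjoint from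
   the remaining ones. *)
have H (r : seq J) : uniq r ->
    nu (B `&` [set y | g y \in r]) = \sum_(j <- r) nu (B `&` g @^-1` [set j]).
  elim: r => [_|j r IH /= /andP[jr ur]].
    by rewrite big_nil -nu0; congr nu; apply/seteqP; split => y // [].
  rewrite big_cons -IH // -nuD.
  - congr nu; rewrite -setIUr; congr setI.
    apply/seteqP; split => y /=; rewrite inE.
      by move=> /orP[/eqP|]; [left|right].
    by move=> [->|->]; rewrite ?eqxx ?orbT.
  - exact: measurableI.
  - apply: measurableI => //; exact: (measurable_fibers (mem r)).
  - apply/seteqP; split => y //= [[_ gy] [_]]; rewrite gy.
    by rewrite (negbTE jr).
rewrite -H ?index_enum_uniq //; congr nu.
by apply/seteqP; split => [y By|y []//]; split => //=; rewrite mem_index_enum.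
Qed.

End fibers.

(** * The partition generated by finitely many sets *)

Section itinerary.
Context (d : measure_display) (X : measurableType d).

(** The fibers are the atoms, possibly empty, of the algebra generated by the first [M] sets. Each
    of these sets is a union of fibers, selected by one entry of the tuple. *)
Definition itinerary (A : nat -> set X) (M : nat) (x : X) : M.-tuple bool :=
  [tuple `[< A k x >] | k < M].

Lemma nth_itinerary A M x k : (k < M)%N ->
  nth false (itinerary A M x) k = `[< A k x >].
Proof. by move=> kM; rewrite -(tnth_nth _ _ (Ordinal kM)) tnth_mktuple. Qed.

Lemma measurable_itinerary A M t : (forall k, measurable (A k)) ->
  measurable (itinerary A M @^-1` [set t]).
Proof.
move=> mA.
have -> : itinerary A M @^-1` [set t] =
    \bigcap_(k in [set: 'I_M]) (if tnth t k then A k else ~` A k).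
  apply/seteqP; split => [x /= <- k _|x H] /=.
    by rewrite tnth_mktuple; case: asboolP.
  apply: eq_from_tnth => k; rewrite tnth_mktuple.
  have := H k I; case: (tnth t k) => ?; by [apply/asboolP | apply/asboolPn].
apply: fin_bigcap_measurable; first exact: finite_finset.
by move=> k _; case: ifP => _ //; exact: measurableC.
Qed.

End itinerary.

(** * Couplings, their matrices on a finite partition, and the lens *)

Section couplings.
Context (d : measure_display) (X : measurableType d) (R : realType).
Context (mu : probability X R).
Implicit Type rho : set (X * X) -> \bar R.

Lemma prob_finitely_additive : finitely_additive (fun A => fine (mu A)).
Proof.
move=> A B mA mB AB; rewrite measureU // fineD //; exact: fin_num_measure.
Qed.

Lemma probf_ge0 A : 0 <= fine (mu A).
Proof. exact: fine_ge0. Qed.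

Lemma probf_le1 A : measurable A -> fine (mu A) <= 1.
Proof.
move=> mA; rewrite -lee_fin fineK ?fin_num_measure //; exact: probability_le1.
Qed.

Lemma probfT : fine (mu setT) = 1.
Proof. by rewrite probability_setT. Qed.

Lemma coupling_additive2 rho A B : is_coupling mu rho -> measurable A ->
  measurable B -> A `&` B = set0 -> rho (A `|` B) = (rho A + rho B)%E.
Proof.
move=> [r0 _ rD _ _] mA mB AB.
apply: (semi_additiveW r0 (semi_sigma_additive_is_additive r0 rD)) => //.
exact: measurableU.
Qed.

(** A coupling is a bare extended-real set function, so finiteness has to be derived: the total mass
    [1] splits into the nonnegative masses of [E] and of its complement. *)
Lemma coupling_fin_num rho E : is_coupling mu rho -> measurable E ->
  rho E \is a fin_num.
Proof.
move=> cr mE; have [_ rge _ r1 _] := cr.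
have : rho (E `|` ~` E) = (rho E + rho (~` E))%E.
  by apply: coupling_additive2; rewrite ?setICr //; exact: measurableC.
rewrite setUv r1 => e; rewrite ge0_fin_numE ?rge //.
rewrite (@le_lt_trans _ _ 1%E) ?ltry // e leeDl // rge //; exact: measurableC.
Qed.

Lemma coupling_finitely_additive rho : is_coupling mu rho ->
  finitely_additive (fun E => fine (rho E)).
Proof.
move=> cr A B mA mB AB; rewrite coupling_additive2 // fineD //;
exact: coupling_fin_num.
Qed.

Lemma coupling_ge0 rho E : is_coupling mu rho -> measurable E ->
  0 <= fine (rho E).
Proof. by move=> [_ rge _ _ _] mE; rewrite fine_ge0 // rge. Qed.

Lemma coupling_le1 rho E : is_coupling mu rho ->
  measurable E -> fine (rho E) <= 1.
Proof.
move=> cr mE; have [_ _ _ r1 _] := cr.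
have mCE := measurableC mE.
have := coupling_finitely_additive cr mE mCE (setICr E).
rewrite setUv r1 /= => ->; rewrite lerDl; exact: (coupling_ge0 cr mCE).
Qed.

(** The fibers of the product map [gh] are rectangles of fibers, so this is [sum_fibers] on
    [X * X]. *)
Lemma coupling_rect rho (I : finType) (g h : X -> I) A B :
  is_coupling mu rho ->
  (forall i, measurable (g @^-1` [set i])) ->
  (forall i, measurable (h @^-1` [set i])) ->
  measurable A -> measurable B ->
  fine (rho (A `*` B)) = \sum_i \sum_j
    fine (rho ((A `&` g @^-1` [set i]) `*` (B `&` h @^-1` [set j]))).
Proof.
move=> cr mg mh mA mB.
pose gh (p : X * X) : I * I := (g p.1, h p.2).
have ghE i j : gh @^-1` [set (i, j)] = (g @^-1` [set i]) `*` (h @^-1` [set j]).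
  by apply/seteqP; split => -[x y] /=; rewrite /gh /= => -[-> ->].
rewrite (@sum_fibers _ _ _ _ gh _ _ _ (coupling_finitely_additive cr)) //.
- rewrite pair_bigA; apply: eq_bigr => -[i j] _ /=; congr (fine (rho _)).
  by rewrite ghE; apply/seteqP; split => -[x y] /= [[? ?] [? ?]].
- by move=> [i j]; rewrite ghE; exact: measurableX.
- exact: measurableX.
Qed.

Lemma coupling_set0l rho A : is_coupling mu rho -> fine (rho (set0 `*` A)) = 0.
Proof. by move=> [r0 _ _ _ _]; rewrite set0X r0. Qed.

Lemma coupling_set0r rho A : is_coupling mu rho -> fine (rho (A `*` set0)) = 0.
Proof. by move=> [r0 _ _ _ _]; rewrite setX0 r0. Qed.

Lemma coupling_marginl rho A : is_coupling mu rho -> measurable A ->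
  fine (rho (A `*` setT)) = fine (mu A).
Proof. by move=> [_ _ _ _ rm] mA; rewrite (rm _ mA).1. Qed.

Lemma coupling_marginr rho A : is_coupling mu rho -> measurable A ->
  fine (rho (setT `*` A)) = fine (mu A).
Proof. by move=> [_ _ _ _ rm] mA; rewrite (rm _ mA).2. Qed.

Section matrix.
Context (I : finType) (g : X -> I).
Hypothesis mg : forall i, measurable (g @^-1` [set i]).

Lemma setI_fiber (P : pred I) i :
  [set x | P (g x)] `&` g @^-1` [set i] =
  if P i then g @^-1` [set i] else set0.
Proof.
case: ifP => Pi; apply/seteqP; split => x //=; first by case.
- by move=> gx; rewrite gx.
- by case=> + gx; rewrite gx Pi.
Qed.

Lemma coupling_pred_rect rho (P Q : pred I) : is_coupling mu rho ->
  fine (rho ([set x | P (g x)] `*` [set x | Q (g x)])) =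
  \sum_i \sum_j (P i)%:R * (Q j)%:R *
    fine (rho ((g @^-1` [set i]) `*` (g @^-1` [set j]))).
Proof.
move=> cr; rewrite (coupling_rect cr mg mg) ?measurable_fibers//.
2,3: exact: measurable_fibers.
apply: eq_bigr => i _; apply: eq_bigr => j _; rewrite !setI_fiber.
by case: (P i); case: (Q j);
  rewrite ?coupling_set0l ?coupling_set0r ?mul1r ?mul0r.
Qed.

(** With [coupling_cols], this is the trace on a finite partition of having both marginals [mu]. The
    converse is [realize_coupling_matrix]. *)
Lemma coupling_rows rho i : is_coupling mu rho ->
  \sum_j fine (rho ((g @^-1` [set i]) `*` (g @^-1` [set j]))) =
  fine (mu (g @^-1` [set i])).
Proof.
move=> cr; rewrite -(coupling_marginl cr) // (coupling_rect cr mg mg) //.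
rewrite [RHS](bigD1 i) //= [X in _ + X]big1 ?addr0 => [|k ki].
  by under [RHS]eq_bigr do rewrite setTI setIid.
apply: big1 => j _; rewrite (_ : _ `&` _ = set0) ?coupling_set0l //.
by apply/seteqP; split => x //= [-> /esym/eqP]; rewrite (negbTE ki).
Qed.

Lemma coupling_cols rho j : is_coupling mu rho ->
  \sum_i fine (rho ((g @^-1` [set i]) `*` (g @^-1` [set j]))) =
  fine (mu (g @^-1` [set j])).
Proof.
move=> cr; rewrite -(coupling_marginr cr) // (coupling_rect cr mg mg) //.
apply: eq_bigr => i _.
rewrite (bigD1 j) //= [X in _ + X]big1 ?addr0 => [|k kj]; first by rewrite setTI setIid.
rewrite (_ : (g @^-1` [set j]) `&` _ = set0) ?coupling_set0r //.
by apply/seteqP; split => x //= [-> /esym/eqP]; rewrite (negbTE kj).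
Qed.

Lemma prob_pred (P : pred I) :
  fine (mu [set x | P (g x)]) = \sum_i (P i)%:R * fine (mu (g @^-1` [set i])).
Proof.
rewrite (sum_fibers mg prob_finitely_additive) ?measurable_fibers //.
2: exact: measurable_fibers.
apply: eq_bigr => i _; rewrite setI_fiber; case: (P i); rewrite ?mul1r //.
by rewrite measure0 mul0r.
Qed.

Lemma prob_fibers_sum1 : \sum_i fine (mu (g @^-1` [set i])) = 1.
Proof.
rewrite -probfT (sum_fibers mg prob_finitely_additive) //.
by apply: eq_bigr => i _; rewrite setTI.
Qed.

End matrix.

(** The diagonal coupling and the product coupling below are the two points whose neighborhoods
    transitivity has to connect. The product also serves as the error term in the construction from
    weak mixing. *)
Lemma diag_coupling :
  is_coupling mu (fun E => mu ((fun x => (x, x)) @^-1` E)).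
Proof.
have mD : measurable_fun setT (fun x : X => (x, x)).
  exact: measurable_fun_pair.
have mpre E : measurable E -> measurable ((fun x : X => (x, x)) @^-1` E).
  by move=> mE; rewrite -[X in measurable X]setTI; exact: mD.
split => //.
- by rewrite preimage_set0 measure0.
- move=> F mF tF mUF; rewrite preimage_bigcup.
  apply: measure_semi_sigma_additive.
  + by move=> n; exact: mpre.
  + by apply/trivIsetP => i j _ _ ij; rewrite -preimage_setI (trivIsetP.1 tF) // preimage_set0.
  + by rewrite -preimage_bigcup; exact: mpre.
- by rewrite preimage_setT probability_setT.
- move=> A mA; split; congr (mu _); apply/seteqP; split => x //=.
  + by case.
  + by case.
Qed.

Lemma prod_rectE A B : measurable A -> measurable B ->
  (mu \x mu)%E (A `*` B) = (mu A * mu B)%E.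
Proof. exact: product_measure1E. Qed.

Lemma prod_coupling : is_coupling mu (mu \x mu)%E.
Proof.
split.
- by rewrite measure0.
- by move=> E _; exact: measure_ge0.
- exact: measure_semi_sigma_additive.
- by rewrite -setXTT prod_rectE // probability_setT mule1.
- by move=> A mA; rewrite !prod_rectE // probability_setT mule1 mul1e.
Qed.

Section lens.
Context (T : X -> X).
Hypotheses (mT : measurable_fun setT T)
  (muT : forall A, measurable A -> mu (T @^-1` A) = mu A).

Lemma lens_coupling rho : is_coupling mu rho -> is_coupling mu (lens T rho).
Proof.
move=> [r0 rge rD r1 rm].
pose TT (p : X * X) := (T p.1, T p.2).
have mTT : measurable_fun setT TT.
  apply: measurable_fun_pair; apply: measurableT_comp => //.
have mpre E : measurable E -> measurable (TT @^-1` E).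
  by move=> mE; rewrite -[X in measurable X]setTI; exact: mTT.
have mTA A : measurable A -> measurable (T @^-1` A).
  by move=> mA; rewrite -[X in measurable X]setTI; exact: mT.
rewrite /lens /pushforward; split.
- by rewrite preimage_set0.
- by move=> E mE; apply: rge; exact: mpre.
- move=> F mF tF mUF; rewrite preimage_bigcup.
  apply: rD.
  + by move=> n; exact: mpre.
  + by apply/trivIsetP => i j _ _ ij; rewrite -preimage_setI (trivIsetP.1 tF) // preimage_set0.
  + by rewrite -preimage_bigcup; exact: mpre.
- by rewrite preimage_setT.
- by move=> A mA; rewrite -muT //; exact: (rm _ (mTA _ mA)).
Qed.

Lemma iter_lens_coupling n rho :
  is_coupling mu rho -> is_coupling mu (iter n (lens T) rho).
Proof. by move=> cr; elim: n => //= n IH; exact: lens_coupling. Qed.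

Lemma iter_lens_rect n rho A B :
  iter n (lens T) rho (A `*` B) =
  rho ((iter n T @^-1` A) `*` (iter n T @^-1` B)).
Proof.
elim: n A B => [|n IH] A B //=.
by rewrite {1}/lens /pushforward; exact: (IH (T @^-1` A) (T @^-1` B)).
Qed.

Lemma measurable_iter_preimage n A :
  measurable A -> measurable (iter n T @^-1` A).
Proof.
elim: n A => [|n IH] A mA //=.
by apply: (IH (T @^-1` A)); rewrite -[X in measurable X]setTI; exact: mT.
Qed.

Lemma prob_iter_preimage n A : measurable A -> mu (iter n T @^-1` A) = mu A.
Proof.
elim: n A => [|n IH] A mA //=.
rewrite -(muT mA) -(IH (T @^-1` A)) //.
by rewrite -[X in measurable X]setTI; exact: mT.
Qed.

End lens.
End couplings.

(** Assembling the sum from bundled measures, one list entry at a time, yields its countable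
    additivity for free. *)
Lemma weighted_restriction (d : measure_display) (Y : measurableType d)
    (R : realType) (m : {measure set Y -> \bar R}) (K : Type) (c : K -> R)
    (D : K -> set Y) (r : seq K) :
  (forall k, 0 <= c k) -> (forall k, measurable (D k)) ->
  exists m' : {measure set Y -> \bar R},
    forall E, m' E = (\sum_(k <- r) (c k)%:E * m (E `&` D k))%E.
Proof.
move=> c0 mD; elim: r => [|k r [m' m'E]].
  by exists mzero => E; rewrite big_nil.
exists (measure_add (mscale (NngNum (c0 k)) (mrestr m (mD k))) m') => E.
by rewrite big_cons -m'E; exact: measure_addE.
Qed.

(** Take the density [w a b / (m a * m b)] with respect to [mu \x mu] on the rectangle of the fibers
    of [a] and [b]. Its first marginal has on the fiber of [a] the constant density
    [(\sum_b w a b) / m a = 1], so it equals [mu] on all measurable sets and not only on fibers; the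
    second marginal is symmetric. *)
Lemma realize_coupling_matrix (d : measure_display) (X : measurableType d)
    (R : realType) (mu : probability X R) (J : finType) (g : X -> J)
    (w : J -> J -> R) :
  (forall j, measurable (g @^-1` [set j])) ->
  (forall a b, 0 <= w a b) ->
  (forall a, \sum_b w a b = fine (mu (g @^-1` [set a]))) ->
  (forall b, \sum_a w a b = fine (mu (g @^-1` [set b]))) ->
  exists2 z, is_coupling mu z &
    forall a b, fine (z ((g @^-1` [set a]) `*` (g @^-1` [set b]))) = w a b.
Proof.
move=> mg w0 wr wc.
pose fib a := g @^-1` [set a]; pose m a := fine (mu (fib a)).
have m0 a : 0 <= m a by exact: probf_ge0.
pose c (ab : J * J) := w ab.1 ab.2 / (m ab.1 * m ab.2).
have c0 ab : 0 <= c ab by rewrite divr_ge0 // mulr_ge0.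
have mf a : measurable (fib a) by exact: mg.
have mfib a b : measurable (fib a `*` fib b) by exact: measurableX.
have [z zE] := @weighted_restriction _ _ _ (mu \x mu)%E _ c
  (fun ab => fib ab.1 `*` fib ab.2) (index_enum _) c0 (fun ab => mfib ab.1 ab.2).
have zX A B : measurable A -> measurable B ->
    z (A `*` B) = (\sum_a \sum_b c (a, b) * fine (mu (A `&` fib a))
                     * fine (mu (B `&` fib b)))%:E.
  move=> mA mB; rewrite zE pair_bigA -sumEFin; apply: eq_bigr => -[a b] _ /=.
  rewrite -setXI prod_rectE; [|exact: measurableI|exact: measurableI].
  rewrite -mulrA !EFinM !fineK // fin_num_measure //; exact: measurableI.
(* On null fibers the left side vanishes, and so does [w a b], being a nonnegative term of a zero
   row or column sum. *)
have cm a b : c (a, b) * m a * m b = w a b.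
  have [a0|a0] := eqVneq (m a) 0.
    rewrite a0 mulr0 mul0r; apply/esym.
    by apply: (@psumr_eq0P _ _ xpredT (w a)) => //; rewrite wr.
  have [b0|b0] := eqVneq (m b) 0.
    rewrite b0 mulr0; apply/esym.
    by apply: (@psumr_eq0P _ _ xpredT (w ^~ b)) => //; rewrite wc.
  by rewrite /c /= ; field; rewrite a0 b0.
have M0 A a : measurable A -> m a = 0 -> fine (mu (A `&` fib a)) = 0.
  move=> mA ma0; apply/eqP; rewrite eq_le probf_ge0 andbT -ma0.
  apply: fine_le; [exact/fin_num_measure/measurableI|exact: fin_num_measure|].
  by apply: le_measure; rewrite ?inE //; exact: measurableI.
have sumM A : measurable A -> \sum_a fine (mu (A `&` fib a)) = fine (mu A).
  by move=> mA; rewrite -(sum_fibers mg (@prob_finitely_additive _ _ _ mu)).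
have zl A : measurable A -> z (A `*` setT) = mu A.
  move=> mA; rewrite zX // -[RHS]fineK ?fin_num_measure // -sumM //.
  congr EFin; apply: eq_bigr => a _.
  have [a0|a0] := eqVneq (m a) 0.
    by rewrite M0 // big1 // => b _; rewrite mulr0 mul0r.
  transitivity ((\sum_b w a b) / m a * fine (mu (A `&` fib a))).
    rewrite !mulr_suml; apply: eq_bigr => b _.
    by rewrite setTI -/(m b) -cm; field.
  by rewrite wr -/(m a) divff // mul1r.
have zr A : measurable A -> z (setT `*` A) = mu A.
  move=> mA; rewrite zX // -[RHS]fineK ?fin_num_measure // -sumM //.
  congr EFin; rewrite exchange_big; apply: eq_bigr => b _ /=.
  have [b0|b0] := eqVneq (m b) 0.
    by rewrite M0 // big1 // => a _; rewrite mulr0.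
  transitivity ((\sum_a w a b) / m b * fine (mu (A `&` fib b))).
    rewrite !mulr_suml; apply: eq_bigr => a _.
    by rewrite setTI -/(m a) -cm; field.
  by rewrite wc -/(m b) divff // mul1r.
have fibI a b : a != b -> fine (mu (fib a `&` fib b)) = 0.
  move=> ab; rewrite (_ : _ `&` _ = set0) ?measure0 //.
  by apply/seteqP; split => x //; rewrite /fib /= => -[-> /eqP]; rewrite (negbTE ab).
exists z.
  split => //; first exact: measure_semi_sigma_additive.
    by rewrite -setXTT zl // probability_setT.
  by move=> A mA; rewrite zl ?zr.
move=> a b; rewrite zX //= (bigD1 a) //= [X in _ + X]big1 => [|a' aa]; last first.
  by apply: big1 => b' _; rewrite fibI 1?eq_sym // mulr0 mul0r.
rewrite (bigD1 b) //= [X in _ + X + _]big1 => [|b' bb]; last first.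
  by rewrite [X in _ * X]fibI 1?eq_sym // mulr0.
by rewrite !addr0 !setIid cm.
Qed.

(** The Cesaro means of the weighted sum tend to [0]; if the sum were at least [1] at every time, so
    would be all its means. This takes the place of intersecting finitely many sets of times of
    density one. *)
Lemma cesaro_small_sum (R : realType) (K : finType) (u : K -> R^nat)
    (c : K -> R) :
  (forall k, (fun N => N.+1%:R^-1 * \sum_(n < N.+1) u k n) @ \oo --> (0 : R)) ->
  exists n, \sum_k c k * u k n < 1.
Proof.
move=> ucv.
have : (fun N => \sum_k c k * (N.+1%:R^-1 * \sum_(n < N.+1) u k n))
    @ \oo --> (\sum_(k : K) c k * 0 : R).
  by apply: cvg_big => [|k _]; [exact: add_continuous|exact: cvgMl_tmp (ucv k)].
rewrite big1 => [|k _]; last by rewrite mulr0.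
move=> /cvgr0Pnorm_lt /(_ 1 ltr01) /filter_ex [N].
move=> /(le_lt_trans (ler_norm _)) H.
apply/not_existsP => nH.
move: H; apply/negP; rewrite -leNgt.
have -> : \sum_k c k * (N.+1%:R^-1 * \sum_(n < N.+1) u k n) =
    N.+1%:R^-1 * \sum_(n < N.+1) \sum_k c k * u k n.
  rewrite exchange_big mulr_sumr; apply: eq_bigr => k _ /=.
  by rewrite -[in RHS]mulr_sumr mulrCA.
rewrite ler_pdivlMl // mulr1 -[leLHS](_ : \sum_(n < N.+1) 1 = _).
  by apply: ler_sum => n _; rewrite leNgt; apply/negP/nH.
by rewrite sumr_const card_ord.
Qed.

(** * From weak mixing to topological weak mixing of the lens *)

Section wm_to_twm.
Context (d : measure_display) (X : measurableType d) (R : realType).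
Context (mu : probability X R).

(** On unions of fibers [z] differs from [rho] by [dl] times a difference of two numbers in
    [[0, 1]]. *)
Lemma coupling_mixture_close (I : finType) (g : X -> I)
    (z rho rho' : set (X * X) -> \bar R) (dl : R) (P Q : pred I) :
  (forall i, measurable (g @^-1` [set i])) ->
  is_coupling mu z -> is_coupling mu rho -> is_coupling mu rho' -> 0 <= dl ->
  (forall i j, fine (z ((g @^-1` [set i]) `*` (g @^-1` [set j]))) =
     (1 - dl) * fine (rho ((g @^-1` [set i]) `*` (g @^-1` [set j]))) +
     dl * fine (rho' ((g @^-1` [set i]) `*` (g @^-1` [set j])))) ->
  `|fine (z ([set x | P (g x)] `*` [set x | Q (g x)])) -
    fine (rho ([set x | P (g x)] `*` [set x | Q (g x)]))| <= dl.
Proof.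
move=> mg cz cr cr' dl0 zE.
set AB := _ `*` _.
have mAB : measurable AB by apply: measurableX; exact: measurable_fibers.
have -> : fine (z AB) = (1 - dl) * fine (rho AB) + dl * fine (rho' AB).
  rewrite /AB (coupling_pred_rect mg P Q cz) (coupling_pred_rect mg P Q cr).
  rewrite (coupling_pred_rect mg P Q cr') !mulr_sumr -big_split.
  apply: eq_bigr => i _; rewrite !mulr_sumr -big_split; apply: eq_bigr => j _ /=.
  by rewrite zE; ring.
have -> : (1 - dl) * fine (rho AB) + dl * fine (rho' AB) - fine (rho AB) =
  dl * (fine (rho' AB) - fine (rho AB)) by ring.
rewrite normrM ger0_norm // ler_piMr // ler_norml.
have := coupling_ge0 cr mAB; have := coupling_ge0 cr' mAB.
have := coupling_le1 cr mAB; have := coupling_le1 cr' mAB.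
by move=> *; apply/andP; split; lra.
Qed.

Context (T : X -> X).
Hypotheses (mT : measurable_fun setT T)
  (muT : forall A, measurable A -> mu (T @^-1` A) = mu A).

(** The weights [(dl * (m i * m k))^-1] turn one bound by [1] on a weighted sum into a relative
    error at most [dl] for all pairs of non-null atoms at once. *)
Lemma wm_almost_independent (I : finType) (g : X -> I) (dl : R) :
  (forall i, measurable (g @^-1` [set i])) ->
  weakly_mixing mu T -> 0 < dl ->
  exists n, forall i k,
    (1 - dl) * (fine (mu (g @^-1` [set i])) * fine (mu (g @^-1` [set k]))) <=
    fine (mu (g @^-1` [set i] `&` iter n T @^-1` (g @^-1` [set k]))).
Proof.
move=> mg wm dl0.
pose m i := fine (mu (g @^-1` [set i])).
pose u (ik : I * I) n := `|fine (mu ((iter n T) @^-1` (g @^-1` [set ik.2])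
   `&` (g @^-1` [set ik.1]))) - m ik.2 * m ik.1|.
have [n nP] := @cesaro_small_sum _ _ u
  (fun ik => (dl * (m ik.1 * m ik.2))^-1) (fun ik => wm _ _ (mg _) (mg _)).
exists n => i k; rewrite -/(m i) -/(m k).
have m0 j : 0 <= m j by exact: probf_ge0.
have [mm0|mm0] := eqVneq (m i * m k) 0.
  by rewrite mm0 mulr0; exact: probf_ge0.
have mmp : 0 < m i * m k by rewrite lt_neqAle eq_sym mm0 mulr_ge0.
have : (dl * (m i * m k))^-1 * u (i, k) n < 1.
  apply: le_lt_trans nP; rewrite (bigD1 (i, k)) //= lerDl.
  apply: sumr_ge0 => j _; apply: mulr_ge0; last exact: normr_ge0.
  by rewrite invr_ge0; apply: mulr_ge0; [exact: ltW|exact: mulr_ge0].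
have dmp : 0 < dl * (m i * m k) by exact: mulr_gt0.
rewrite ltr_pdivrMl // mulr1 /u /= ltr_norml [m k * m i]mulrC setIC.
by move=> /andP[+ _]; lra.
Qed.

(** The order of quantifiers matters: [n] depends on [L] and [eps] only, so one time serves two
    pairs [(s, r)]. This is what gives topological weak mixing and not only transitivity. *)
Lemma wm_joint_approximation (L : seq (set X)) (eps : R) :
  weakly_mixing mu T -> (forall A, A \in L -> measurable A) -> 0 < eps ->
  exists n, forall s r, is_coupling mu s -> is_coupling mu r ->
  exists2 z, is_coupling mu z & forall A B, A \in L -> B \in L ->
    `|fine (z (A `*` B)) - fine (s (A `*` B))| < eps /\
    `|fine (iter n (lens T) z (A `*` B)) - fine (r (A `*` B))| < eps.
Proof.
move=> wm mL eps0.
pose A k := nth set0 L k; pose M := size L.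
have mA k : measurable (A k).
  have [kM|kM] := ltnP k M; first exact/mL/mem_nth.
  by rewrite /A nth_default.
pose I : finType := M.-tuple bool; pose g : X -> I := itinerary A M.
have mg i : measurable (g @^-1` [set i]) by exact: measurable_itinerary.
(* Strictly below [eps], and at most [1] so that the weights [w] are nonnegative. *)
pose dl := Num.min (eps / 2) 1.
have dl0 : 0 < dl by rewrite lt_min ltr01 divr_gt0.
have dl1 : dl <= 1 by rewrite ge_min lexx orbT.
have dle : dl < eps.
  rewrite gt_min; apply/orP; left; rewrite ltr_pdivrMr //; lra.
have LE B : B \in L -> exists P : pred I, B = [set x | P (g x)].
  move=> BL; exists (fun t : M.-tuple bool => nth false t (index B L)).
  have iM : (index B L < M)%N by rewrite index_mem.
  by apply/seteqP; split => x /=; rewrite nth_itinerary // /A nth_index // =>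
    /asboolP.
have [n nP] := wm_almost_independent mg wm dl0.
exists n => s r cs cr.
pose h x := g (iter n T x).
pose m i := fine (mu (g @^-1` [set i])).
pose S i j := fine (s ((g @^-1` [set i]) `*` (g @^-1` [set j]))).
pose Q i j := fine (r ((g @^-1` [set i]) `*` (g @^-1` [set j]))).
pose mm i k := fine (mu (g @^-1` [set i] `&` h @^-1` [set k])).
pose e i k := mm i k - (1 - dl) * (m i * m k).
have mh i : measurable (h @^-1` [set i]) by exact: (measurable_iter_preimage mT n (mg i)).
have muh i : fine (mu (h @^-1` [set i])) = m i.
  by congr fine; exact: (prob_iter_preimage mT muT n (mg i)).
have m1 : \sum_i m i = 1 by exact: prob_fibers_sum1.
have mm_row i : \sum_k mm i k = m i.
  by rewrite -(sum_fibers mh (@prob_finitely_additive _ _ _ mu)).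
have mm_col k : \sum_i mm i k = m k.
  rewrite -muh (sum_fibers mg (@prob_finitely_additive _ _ _ mu)) //.
  by apply: eq_bigr => i _; rewrite setIC.
have e0 i k : 0 <= e i k by rewrite subr_ge0; exact: nP.
have e_row i : \sum_k e i k = dl * m i.
  by rewrite /e sumrB mm_row -mulr_sumr -mulr_sumr m1; ring.
have e_col k : \sum_i e i k = dl * m k.
  by rewrite /e sumrB mm_col -mulr_sumr -mulr_suml m1; ring.
pose gh x : I * I := (g x, h x).
have ghE ik : gh @^-1` [set ik] = g @^-1` [set ik.1] `&` h @^-1` [set ik.2].
  by case: ik => i k; apply/seteqP; split => x /=; rewrite /gh /= => -[-> ->].
have S0 i j : 0 <= S i j by apply: (coupling_ge0 cs); exact: measurableX.
have Q0 i j : 0 <= Q i j by apply: (coupling_ge0 cr); exact: measurableX.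
have S_row i : \sum_j S i j = m i by exact: (coupling_rows mg i cs).
have S_col j : \sum_i S i j = m j by exact: (coupling_cols mg j cs).
have Q_row i : \sum_j Q i j = m i by exact: (coupling_rows mg i cr).
have Q_col j : \sum_i Q i j = m j by exact: (coupling_cols mg j cr).
(* An index [(i, k)] records the atoms of [x] and of [iter n T x]. The first summand couples the
   present by [S] and, independently, the future by [Q]; its row sum is [(1 - dl) * (m i * m k)].
   The entries of [e] add up to [dl], so the second summand has row sum [e i k], which completes it
   to [mm i k]. *)
pose w (a b : I * I) :=
  (1 - dl) * (S a.1 b.1 * Q a.2 b.2) + e a.1 a.2 * e b.1 b.2 / dl.
have [z cz zE] : exists2 z, is_coupling mu z &
    forall a b, fine (z ((gh @^-1` [set a]) `*` (gh @^-1` [set b]))) = w a b.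
  apply: realize_coupling_matrix.
  - by move=> a; rewrite ghE; exact: measurableI.
  - move=> a b; apply: addr_ge0.
      by apply: mulr_ge0; [rewrite subr_ge0|exact: mulr_ge0].
    by apply: divr_ge0; [exact: mulr_ge0|exact: ltW].
  - move=> [i k]; rewrite ghE -/(mm i k) -(pair_bigA _ (fun j l => w (i, k) (j, l))).
    transitivity (\sum_j ((1 - dl) * (S i j * m k) + e i k * m j)).
      apply: eq_bigr => j _; rewrite big_split /= -mulr_sumr -mulr_sumr.
      rewrite -mulr_suml -mulr_sumr e_row Q_row.
      by congr (_ + _); field; rewrite gt_eqF.
    rewrite big_split /= -!mulr_sumr -mulr_suml m1 S_row.
    by rewrite /e -/(m i); ring.
  - move=> [j l]; rewrite ghE -/(mm j l) -(pair_bigA _ (fun i k => w (i, k) (j, l))).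
    transitivity (\sum_i ((1 - dl) * (S i j * m l) + e j l * m i)).
      apply: eq_bigr => i _; rewrite big_split /= -mulr_sumr -mulr_sumr.
      rewrite -mulr_suml -mulr_suml e_row Q_col.
      by congr (_ + _); field; rewrite gt_eqF.
    rewrite big_split /= -!mulr_sumr -mulr_suml m1 S_col.
    by rewrite /e -/(m j); ring.
exists z => // A' B' /LE [P ->] /LE [P' ->].
have prodE i j : fine ((mu \x mu)%E ((g @^-1` [set i]) `*` (g @^-1` [set j]))) =
  m i * m j by rewrite prod_rectE // fineM ?fin_num_measure.
split; apply: le_lt_trans dle;
  apply: (coupling_mixture_close P P' mg _ _ (prod_coupling mu)) => //.
- exact: ltW.
(* Summing out the future indices [k], [l] leaves [(1 - dl) * S i j + dl * (m i * m j)]. *)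
- move=> i j; rewrite prodE (coupling_rect cz mh mh) //.
  transitivity (\sum_k \sum_l w (i, k) (j, l)).
    by apply: eq_bigr => k _; apply: eq_bigr => l _; rewrite -zE !ghE.
  transitivity (\sum_k ((1 - dl) * S i j * m k + e i k * m j)).
    apply: eq_bigr => k _; rewrite big_split /= -mulr_sumr -mulr_sumr.
    rewrite -mulr_suml -mulr_sumr e_row Q_row.
    by rewrite mulrA; congr (_ + _); field; rewrite gt_eqF.
  by rewrite big_split /= -mulr_sumr -mulr_suml m1 e_row /S; ring.
- exact: iter_lens_coupling.
- exact: ltW.
(* The image under the lens is read on the fibers of [h], so now the present indices [i], [j] are
   summed out. *)
- move=> k l; rewrite prodE iter_lens_rect (coupling_rect cz mg mg); [|exact: mh|exact: mh].
  transitivity (\sum_i \sum_j w (i, k) (j, l)).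
    apply: eq_bigr => i _; apply: eq_bigr => j _; rewrite -zE !ghE.
    by rewrite ![g @^-1` _ `&` _]setIC.
  transitivity (\sum_i ((1 - dl) * Q k l * m i + e i k * m l)).
    apply: eq_bigr => i _; rewrite big_split /= -mulr_sumr -mulr_suml.
    rewrite -mulr_suml -mulr_sumr e_col S_row.
    by congr (_ + _); [ring|field; rewrite gt_eqF].
  by rewrite big_split /= -mulr_sumr -mulr_suml m1 e_col /Q; ring.
Qed.

(** Replacing a list of rectangles by the list of all their sides shrinks the neighborhood, and lets
    several neighborhoods be merged by concatenating lists. *)
Lemma C2_open_basic U r : C2_open mu U -> U r ->
  exists (L : seq (set X)) (eps : R), [/\ 0 < eps,
    forall A, A \in L -> measurable A &
    forall z, is_coupling mu z ->
      (forall A B, A \in L -> B \in L ->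
         `|fine (z (A `*` B)) - fine (r (A `*` B))| < eps) -> U z].
Proof.
move=> [_ oU] /oU [F [eps eps0 [mF FU]]].
exists (map fst F ++ map snd F), eps; split => // [A|z cz zr].
  by rewrite mem_cat => /orP[] /mapP[AB /mF[m1 m2] ->].
apply: FU; split => // AB ABF; apply: zr; rewrite mem_cat; apply/orP.
- by left; apply/mapP; exists AB.
- by right; apply/mapP; exists AB.
Qed.

(** The four basic neighborhoods are merged into one list and one radius; the common [n] then moves
    [z1] from [V1] to [U1] and [z2] from [V2] to [U2]. *)
Lemma wm_top_weakly_mixing :
  weakly_mixing mu T -> top_weakly_mixing (C2_open mu) (lens T).
Proof.
move=> wm U V oU oV [r /oU[U1 [U2 [oU1 oU2 U1r U2r UU]]]].
move=> [s /oV[V1 [V2 [oV1 oV2 V1s V2s VV]]]].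
have [La [a [a0 mLa aU]]] := C2_open_basic oU1 U1r.
have [Lb [b [b0 mLb bU]]] := C2_open_basic oU2 U2r.
have [Lc [c [c0 mLc cV]]] := C2_open_basic oV1 V1s.
have [Le [e [e0 mLe eV]]] := C2_open_basic oV2 V2s.
pose L := (La ++ Lb) ++ (Lc ++ Le).
pose eps := Num.min (Num.min a b) (Num.min c e).
have eps0 : 0 < eps by rewrite !lt_min a0 b0 c0 e0.
have [ea eb ec ee] : [/\ eps <= a, eps <= b, eps <= c & eps <= e].
  by rewrite /eps; split; rewrite !ge_min lexx ?orbT.
have [|n nP] := wm_joint_approximation wm _ eps0 (L := L).
  by move=> A; rewrite !mem_cat => /orP[/orP[]|/orP[]];
    [exact: mLa|exact: mLb|exact: mLc|exact: mLe].
have [z1 cz1 z1P] := nP _ _ (oV1.1 _ V1s) (oU1.1 _ U1r).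
have [z2 cz2 z2P] := nP _ _ (oV2.1 _ V2s) (oU2.1 _ U2r).
exists n, (z1, z2).
  apply: VV; split => /=.
  - apply: cV => // A B AL BL; apply: lt_le_trans ec.
    by apply: (z1P A B _ _).1; rewrite !mem_cat ?AL ?BL ?orbT.
  - apply: eV => // A B AL BL; apply: lt_le_trans ee.
    by apply: (z2P A B _ _).1; rewrite !mem_cat ?AL ?BL ?orbT.
have -> : iter n (fun p => (lens T p.1, lens T p.2)) (z1, z2) =
    (iter n (lens T) z1, iter n (lens T) z2).
  by elim: n {nP z1P z2P} => //= n ->.
apply: UU; split => /=.
- apply: aU => [|A B AL BL]; first exact: iter_lens_coupling.
  apply: lt_le_trans ea.
  by apply: (z1P A B _ _).2; rewrite !mem_cat ?AL ?BL ?orbT.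
- apply: bU => [|A B AL BL]; first exact: iter_lens_coupling.
  apply: lt_le_trans eb.
  by apply: (z2P A B _ _).2; rewrite !mem_cat ?AL ?BL ?orbT.
Qed.

End wm_to_twm.

(** * From topological weak mixing to transitivity *)

Lemma twm_transitive (Z : Type) (op : set Z -> Prop) (f : Z -> Z) :
  top_weakly_mixing op f -> top_transitive op f.
Proof.
move=> twm U V oU oV [u Uu] [v Vv].
have prodP W : op W -> prod_open op (W `*` W).
  by move=> oW z [Wz1 Wz2]; exists W, W; split.
have [||n [z [Vz _] Uz]] := twm _ _ (prodP _ oU) (prodP _ oV).
- by exists (u, u).
- by exists (v, v).
exists n, z.1 => //; move: Uz => [+ _].
suff -> : (iter n (fun p => (f p.1, f p.2)) z).1 = iter n f z.1 by [].
by elim: n => //= n ->.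
Qed.

(** * Sums of rank one kernels on a finite probability space *)

Section finite_kernels.
Context (R : realType) (I : finType) (m : I -> R) (f : nat -> I -> R).
Hypothesis m0 : forall i, 0 <= m i.

Let inner k l := \sum_i m i * (f k i * f l i).
Let kernel (s : seq nat) i z := \sum_(k <- s) f k i * f k z.
(** By [kernel_gram] this is the inner product of two kernels in [L^2] of [m x m]. Kernels are sums
    over lists, not averages; the lengths enter in [transitive_gram_small]. *)
Let gram (s t : seq nat) := \sum_(k <- s) \sum_(l <- t) inner k l ^+ 2.

Lemma kernel_pairing (rho : I -> I -> R) s t :
  \sum_i \sum_j \sum_z rho i j * m z * (kernel s i z * kernel t j z) =
  \sum_(k <- s) \sum_(l <- t)
    inner k l * (\sum_i \sum_j rho i j * (f k i * f l j)).
Proof.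
transitivity (\sum_i \sum_j \sum_z \sum_(k <- s) \sum_(l <- t)
    (m z * (f k z * f l z)) * (rho i j * (f k i * f l j))).
  apply: eq_bigr => i _; apply: eq_bigr => j _; apply: eq_bigr => z _.
  rewrite /kernel mulr_suml mulr_sumr; apply: eq_bigr => k _.
  by rewrite !mulr_sumr; apply: eq_bigr => l _; ring.
rewrite (eq_bigr (fun i => \sum_(k <- s) \sum_(l <- t) \sum_j
   inner k l * (rho i j * (f k i * f l j)))) => [|i _]; last first.
  rewrite (eq_bigr (fun j => \sum_(k <- s) \sum_(l <- t)
     inner k l * (rho i j * (f k i * f l j)))) => [|j _].
    rewrite exchange_big; apply: eq_bigr => k _.
    by rewrite exchange_big.
  rewrite exchange_big; apply: eq_bigr => k _.
  rewrite exchange_big; apply: eq_bigr => l _.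
  by rewrite -mulr_suml.
rewrite exchange_big; apply: eq_bigr => k _.
rewrite exchange_big; apply: eq_bigr => l _.
rewrite mulr_sumr; apply: eq_bigr => i _.
by rewrite mulr_sumr.
Qed.

(** The pairing for the diagonal matrix, in which the second factor of each term becomes [inner k l]
    again. *)
Lemma kernel_gram s t :
  \sum_i \sum_z m i * m z * (kernel s i z * kernel t i z) = gram s t.
Proof.
transitivity (\sum_i \sum_j \sum_z
    (m i * (i == j)%:R) * m z * (kernel s i z * kernel t j z)).
  apply: eq_bigr => i _; rewrite [RHS](bigD1 i) //= [X in _ = _ + X]big1 ?addr0.
    by apply: eq_bigr => z _; rewrite eqxx mulr1.
  by move=> j ji; apply: big1 => z _; rewrite eq_sym (negbTE ji) !(mulr0, mul0r).
rewrite (kernel_pairing (fun i j => m i * (i == j)%:R)); apply: eq_bigr => k _.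
apply: eq_bigr => l _; rewrite expr2; congr (_ * _); rewrite /inner; apply: eq_bigr => i _.
rewrite (bigD1 i) //= [X in _ + X]big1 ?addr0; first by rewrite eqxx mulr1.
by move=> j ji; rewrite eq_sym (negbTE ji) mulr0 mul0r.
Qed.

(** The difference of integrands is bounded by squares each depending on only one of [i], [j]. Their
    sums against [rho] see only its marginals [m], which makes the bound independent of [rho]. *)
Lemma kernel_pairing_diff (rho : I -> I -> R) s t :
  (forall i j, 0 <= rho i j) ->
  (forall i, \sum_j rho i j = m i) -> (forall j, \sum_i rho i j = m j) ->
  \sum_(k <- s) \sum_(l <- s)
    inner k l * (\sum_i \sum_j rho i j * (f k i * f l j)) -
  \sum_(k <- t) \sum_(l <- t)
    inner k l * (\sum_i \sum_j rho i j * (f k i * f l j)) <=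
  4 * (gram s s - 2 * gram s t + gram t t) + (gram s s + gram t t) / 8.
Proof.
move=> rho0 rrow rcol; rewrite -!kernel_pairing.
pose F := kernel s; pose G := kernel t; pose D i z := F i z - G i z.
pose S (H : I -> I -> I -> R) :=
  \sum_i \sum_j \sum_z rho i j * m z * H i j z.
have rowE (H : I -> I -> R) :
    S (fun i j z => H i z) = \sum_i \sum_z m i * m z * H i z.
  apply: eq_bigr => i _; rewrite exchange_big; apply: eq_bigr => z _.
  by rewrite -!mulr_suml rrow.
have colE (H : I -> I -> R) :
    S (fun i j z => H j z) = \sum_i \sum_z m i * m z * H i z.
  rewrite /S exchange_big; apply: eq_bigr => j _; rewrite exchange_big.
  by apply: eq_bigr => z _; rewrite -!mulr_suml rcol.
have DE : \sum_i \sum_z m i * m z * D i z ^+ 2 =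
    gram s s - 2 * gram s t + gram t t.
  rewrite -!kernel_gram mulr_sumr -sumrB -big_split; apply: eq_bigr => i _ /=.
  rewrite mulr_sumr -sumrB -big_split; apply: eq_bigr => z _ /=.
  by rewrite /D /F /G; ring.
have SD H H' : S (fun i j z => H i j z + H' i j z) = S H + S H'.
  rewrite /S -big_split; apply: eq_bigr => i _; rewrite -big_split.
  apply: eq_bigr => j _; rewrite -big_split; apply: eq_bigr => z _.
  by rewrite mulrDr.
have SZ a H : S (fun i j z => a * H i j z) = a * S H.
  rewrite /S mulr_sumr; apply: eq_bigr => i _; rewrite mulr_sumr.
  apply: eq_bigr => j _; rewrite mulr_sumr; apply: eq_bigr => z _.
  by rewrite mulrCA.
have -> : 4 * (gram s s - 2 * gram s t + gram t t) + (gram s s + gram t t) / 8 =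
  S (fun i j z => 2 * D i z ^+ 2 + (2 * D j z ^+ 2 +
    (8^-1 * F j z ^+ 2 + 8^-1 * G i z ^+ 2))).
  rewrite !SD !SZ.
  rewrite (rowE (fun i z => D i z ^+ 2)) (colE (fun i z => D i z ^+ 2)).
  rewrite (colE (fun i z => F i z ^+ 2)) (rowE (fun i z => G i z ^+ 2)).
  rewrite DE.
  have sqE t' : \sum_i \sum_z m i * m z * kernel t' i z ^+ 2 = gram t' t'.
    rewrite -kernel_gram; apply: eq_bigr => i _; apply: eq_bigr => z _.
    by rewrite expr2.
  by rewrite !sqE; field.
rewrite -/(S (fun i j z => F i z * F j z)) -/(S (fun i j z => G i z * G j z)).
rewrite -[X in _ - X]mul1r -mulNr -SZ -SD; apply: ler_sum => i _.
apply: ler_sum => j _; apply: ler_sum => z _; apply: ler_wpM2l.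
  exact: mulr_ge0.
(* AM-GM: F_i F_j - G_i G_j = D_i F_j + G_i D_j and 8 x y <= 16 x^2 + y^2. *)
rewrite /D; set x := F i z; set y := F j z; set u := G i z; set v := G j z.
have := sqr_ge0 (4 * (x - u) - y); have := sqr_ge0 (4 * (y - v) - u).
rewrite !expr2; lra.
Qed.

(** The sum [y] is the mean of the kernel times [g i * g z]. Its square is at most the mean of the
    square, by nonnegativity of the variance, and the factor [g i * g z] lies in [[0, 1]]. *)
Lemma kernel_bessel (g : I -> R) s : (\sum_i m i = 1) ->
  (forall i, 0 <= g i <= 1) ->
  (\sum_(k <- s) (\sum_i m i * (f k i * g i)) ^+ 2) ^+ 2 <= gram s s.
Proof.
move=> m1 g01; set y := \sum_(k <- s) _.
have yE : y = \sum_i \sum_z m i * m z * (kernel s i z * (g i * g z)).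
  transitivity (\sum_i \sum_z \sum_(k <- s)
      (m i * (f k i * g i)) * (m z * (f k z * g z))); last first.
    apply: eq_bigr => i _; apply: eq_bigr => z _.
    by rewrite /kernel mulr_suml mulr_sumr; apply: eq_bigr => k _; ring.
  under eq_bigr do rewrite exchange_big.
  rewrite exchange_big; apply: eq_bigr => k _ /=.
  by rewrite expr2 mulr_suml; apply: eq_bigr => i _; rewrite mulr_sumr.
move: (y) yE => {}y yE.
have mm1 : \sum_i \sum_z m i * m z = 1.
  by under eq_bigr do rewrite -mulr_sumr m1 mulr1; rewrite m1.
have : 0 <= \sum_i \sum_z m i * m z * (kernel s i z * (g i * g z) - y) ^+ 2.
  apply: sumr_ge0 => i _; apply: sumr_ge0 => z _.
  by apply: mulr_ge0; [exact: mulr_ge0|exact: sqr_ge0].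
have -> : \sum_i \sum_z m i * m z * (kernel s i z * (g i * g z) - y) ^+ 2 =
    \sum_i \sum_z m i * m z * (kernel s i z * (g i * g z)) ^+ 2 - y ^+ 2.
  transitivity (\sum_i \sum_z m i * m z * (kernel s i z * (g i * g z)) ^+ 2
     - 2 * y * (\sum_i \sum_z m i * m z * (kernel s i z * (g i * g z)))
     + y ^+ 2 * (\sum_i \sum_z m i * m z)); last first.
    by rewrite -yE mm1; ring.
  rewrite !mulr_sumr -sumrB -big_split; apply: eq_bigr => i _ /=.
  rewrite !mulr_sumr -sumrB -big_split; apply: eq_bigr => z _ /=.
  by ring.
rewrite subr_ge0 => /le_trans; apply; rewrite -kernel_gram.
apply: ler_sum => i _; apply: ler_sum => z _; apply: ler_wpM2l.
  exact: mulr_ge0.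
rewrite -expr2 exprMn ler_piMr ?sqr_ge0 // exprn_ile1 //.
- by apply: mulr_ge0; [case/andP: (g01 i)|case/andP: (g01 z)].
- by apply: mulr_ile1; [case/andP: (g01 i)|case/andP: (g01 z)|
    case/andP: (g01 i)|case/andP: (g01 z)].
Qed.

End finite_kernels.

(** Averaging over the shifts in [s] changes a sum over a window of times by a constant [C] at most,
    so the means of the squares are eventually small; the inequality [absx] passes from squares to
    absolute values. *)
Lemma cesaro_of_shifts (R : realType) (x : R^nat) :
  (forall n, `|x n| <= 1) ->
  (forall eta : R, 0 < eta -> exists2 s : seq nat, s != [::] &
     forall n, \sum_(k <- s) x (k + n)%N ^+ 2 <= (size s)%:R * eta) ->
  (fun N => N.+1%:R^-1 * \sum_(n < N.+1) `|x n|) @ \oo --> (0 : R).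
Proof.
move=> x1 xs; apply/cvgr0Pnorm_lt => eps eps0.
pose dl := eps / 4.
have dl0 : 0 < dl by rewrite divr_gt0.
have [s s0 sP] := xs (dl ^+ 2) (exprn_gt0 _ dl0).
have ss0 : 0 < (size s)%:R :> R.
  by rewrite ltr0n lt0n; apply: contra s0 => /nilP ->.
pose C : R := (\sum_(k <- s) k%:R) / (size s)%:R.
have x2 n : x n ^+ 2 <= 1.
  by rewrite -real_normK ?num_real // exprn_ile1.
have avg N : \sum_(n < N) x n ^+ 2 <= N%:R * dl ^+ 2 + C.
  rewrite -(ler_pM2l ss0) mulrDr [X in _ + X]mulrC /C divfK ?gt_eqF //.
  (* Shifting the window by [k] loses only its first [k] terms, each at most [1]. *)
  have tele k : \sum_(n < N) x n ^+ 2 <= \sum_(n < N) x (k + n)%N ^+ 2 + k%:R.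
    apply: (@le_trans _ _ (\sum_(n < k + N) x n ^+ 2)).
      rewrite addnC big_split_ord /= lerDl.
      by apply: sumr_ge0 => n _; exact: sqr_ge0.
    rewrite big_split_ord /= addrC lerD2l.
    rewrite -[leRHS](_ : \sum_(n < k) 1 = _); first exact: ler_sum.
    by rewrite sumr_const card_ord.
  apply: (@le_trans _ _ (\sum_(k <- s) (\sum_(n < N) x (k + n)%N ^+ 2 + k%:R))).
    rewrite mulr_natl -[leLHS](_ : \sum_(k <- s) (\sum_(n < N) x n ^+ 2) = _).
      exact: ler_sum.
    by rewrite big_const_seq count_predT iter_addr_0.
  rewrite big_split /= lerD2r exchange_big /=.
  apply: (@le_trans _ _ (\sum_(n < N) (size s)%:R * dl ^+ 2)).
    by apply: ler_sum => n _; exact: sP.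
  by rewrite sumr_const card_ord -[_ *+ N]mulr_natl mulrCA.
have absx n : `|x n| <= dl + dl^-1 * x n ^+ 2.
  have := sqr_ge0 (`|x n| - dl); have := sqr_ge0 (x n).
  rewrite sqrrB real_normK ?num_real // => a0 h.
  rewrite -(ler_pM2l dl0) mulrDr mulVKf ?gt_eqF //.
  have := normr_ge0 (x n); nra.
near=> N.
have N0 : 0 < N.+1%:R :> R by rewrite ltr0n.
rewrite ger0_norm; last first.
  by rewrite mulr_ge0 ?invr_ge0 ?ler0n // sumr_ge0.
(* For large [N] the boundary term costs one more [dl] on average, for a total of [3 * dl], below
   [eps = 4 * dl]. *)
have CN : C / dl <= N.+1%:R * dl.
  rewrite ler_pdivrMr // -mulrA -ler_pdivrMr ?mulr_gt0 //.
  apply: (@le_trans _ _ N%:R); last by rewrite ler_nat.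
  by near: N; exact: nbhs_infty_ger.
rewrite ltr_pdivrMl //.
apply: (@le_lt_trans _ _ (\sum_(n < N.+1) (dl + dl^-1 * x n ^+ 2))).
  exact: ler_sum.
rewrite big_split /= sumr_const card_ord -mulr_sumr -[dl *+ _]mulr_natl.
apply: (@le_lt_trans _ _ (N.+1%:R * dl + dl^-1 * (N.+1%:R * dl ^+ 2 + C))).
  by rewrite lerD2l; apply: ler_wpM2l; [rewrite invr_ge0 ltW|exact: avg].
have -> : dl^-1 * (N.+1%:R * dl ^+ 2 + C) = N.+1%:R * dl + C / dl.
  by field; rewrite gt_eqF.
apply: (@le_lt_trans _ _ (3 * (N.+1%:R * dl))); first by lra.
rewrite mulrCA ltr_pM2l // /dl; lra.
Unshelve. all: by end_near. Qed.

(** * Correlations of centered indicators as finite sums over atoms *)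

Section itinerary_sums.
Context (d : measure_display) (X : measurableType d) (R : realType).
Context (mu : probability X R) (E : nat -> set X) (M : nat).
Hypothesis mE : forall k, measurable (E k).

Let fib (t : M.-tuple bool) := itinerary E M @^-1` [set t].
Let m t := fine (mu (fib t)).
Let bit (k : nat) (t : M.-tuple bool) : R := (nth false t k)%:R.

Lemma itinerary_set k : (k < M)%N ->
  E k = [set x | nth false (itinerary E M x) k].
Proof.
by move=> kM; apply/seteqP; split => x /=; rewrite nth_itinerary // => /asboolP.
Qed.

Lemma itinerary_prob k : (k < M)%N -> \sum_t m t * bit k t = fine (mu (E k)).
Proof.
move=> kM; rewrite [in RHS](itinerary_set kM).
rewrite (prob_pred mu (fun t => measurable_itinerary t mE)
  (fun t : M.-tuple bool => nth false t k)).
by apply: eq_bigr => t _; rewrite mulrC.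
Qed.

Lemma itinerary_probI k l : (k < M)%N -> (l < M)%N ->
  \sum_t m t * (bit k t * bit l t) = fine (mu (E k `&` E l)).
Proof.
move=> kM lM.
have -> : E k `&` E l = [set x | nth false (itinerary E M x) k &&
    nth false (itinerary E M x) l].
  by rewrite {1}(itinerary_set kM) {1}(itinerary_set lM);
    apply/seteqP; split => x /= /andP.
rewrite (prob_pred mu (fun t => measurable_itinerary t mE)
  (fun t : M.-tuple bool => nth false t k && nth false t l)).
by apply: eq_bigr => t _; rewrite mulrC -mulnb natrM.
Qed.

Lemma itinerary_coupling rho k l : is_coupling mu rho ->
  (k < M)%N -> (l < M)%N ->
  \sum_t \sum_u fine (rho (fib t `*` fib u)) * (bit k t * bit l u) =
  fine (rho (E k `*` E l)).
Proof.
move=> cr kM lM; rewrite [in RHS](itinerary_set kM) [in RHS](itinerary_set lM).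
rewrite (coupling_pred_rect (fun t => measurable_itinerary t mE)
  (fun t : M.-tuple bool => nth false t k)
  (fun t : M.-tuple bool => nth false t l) cr).
by apply: eq_bigr => t _; apply: eq_bigr => u _; rewrite mulrC.
Qed.

Lemma itinerary_sum1 : \sum_t m t = 1.
Proof. exact: (prob_fibers_sum1 mu (fun t => measurable_itinerary t mE)). Qed.

(** The constants [a] and [b] are free so that one factor may stay uncentered: [gram_bessel] takes
    [b = 0]. *)
Lemma centered_probI k l (a b : R) : (k < M)%N -> (l < M)%N ->
  \sum_t m t * ((bit k t - a) * (bit l t - b)) =
  fine (mu (E k `&` E l)) - b * fine (mu (E k)) - a * fine (mu (E l)) + a * b.
Proof.
move=> kM lM.
rewrite -itinerary_probI // -(itinerary_prob kM) -(itinerary_prob lM).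
rewrite -[a * b]mulr1 -itinerary_sum1 !mulr_sumr -!sumrB -big_split.
by apply: eq_bigr => t _ /=; ring.
Qed.

Lemma centered_coupling rho k l (a b : R) : is_coupling mu rho ->
  (k < M)%N -> (l < M)%N ->
  \sum_t \sum_u fine (rho (fib t `*` fib u)) * ((bit k t - a) * (bit l u - b)) =
  fine (rho (E k `*` E l)) - b * fine (mu (E k)) - a * fine (mu (E l)) + a * b.
Proof.
move=> cr kM lM.
pose r t u := fine (rho (fib t `*` fib u)).
have rrow t : \sum_u r t u = m t.
  exact: (coupling_rows (fun t => measurable_itinerary t mE) t cr).
have rcol u : \sum_t r t u = m u.
  exact: (coupling_cols (fun t => measurable_itinerary t mE) u cr).
have sk : \sum_t \sum_u r t u * bit k t = fine (mu (E k)).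
  rewrite -(itinerary_prob kM); apply: eq_bigr => t _.
  by rewrite -mulr_suml rrow.
have sl : \sum_t \sum_u r t u * bit l u = fine (mu (E l)).
  rewrite -(itinerary_prob lM) exchange_big; apply: eq_bigr => t _.
  by rewrite -mulr_suml rcol.
have s1 : \sum_t \sum_u r t u = 1.
  by rewrite -itinerary_sum1; apply: eq_bigr => t _; exact: rrow.
rewrite -itinerary_coupling // -sk -sl -[a * b]mulr1 -s1 !mulr_sumr.
rewrite -!sumrB -big_split; apply: eq_bigr => t _ /=.
rewrite !mulr_sumr -!sumrB -big_split; apply: eq_bigr => u _ /=.
by rewrite /r; ring.
Qed.

End itinerary_sums.

(** Finitely many strict inequalities leave a common slack [eps], found by induction on [F]. *)
Lemma rect_nbhd_open (d : measure_display) (X : measurableType d)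
    (R : realType) (mu : probability X R) r (F : seq (set X * set X)) (dl : R) :
  (forall AB, AB \in F -> measurable AB.1 /\ measurable AB.2) ->
  C2_open mu (C2 mu `&` rect_nbhd r F dl).
Proof.
move=> mF; split => [z []//|rho [crho rrho]].
have [eps eps0 epsP] : exists2 eps : R, 0 < eps & forall AB, AB \in F ->
    `|fine (rho (AB.1 `*` AB.2)) - fine (r (AB.1 `*` AB.2))| + eps <= dl.
  elim: F {mF} rrho => [|CD F IH] rrho; first by exists 1.
  have [|eps eps0 epsP] := IH.
    by move=> AB ABF; apply: rrho; rewrite inE ABF orbT.
  pose e' := dl - `|fine (rho (CD.1 `*` CD.2)) - fine (r (CD.1 `*` CD.2))|.
  have e'0 : 0 < e' by rewrite subr_gt0; apply: rrho; rewrite inE eqxx.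
  exists (Num.min eps e'); first by rewrite lt_min eps0.
  move=> AB; rewrite inE => /orP[/eqP ->|ABF].
    by rewrite -lerBrDl ge_min lexx orbT.
  by apply: le_trans (epsP _ ABF); rewrite lerD2l ge_min lexx.
exists F, eps => //; split => // z [cz zrho]; split => // AB ABF.
apply: lt_le_trans (epsP _ ABF).
rewrite -(subrKA (fine (rho (AB.1 `*` AB.2)))).
apply: (le_lt_trans (ler_normD _ _)); rewrite [ltLHS]addrC ltrD2l.
exact: zrho.
Qed.

(** * From transitivity of the lens to weak mixing *)

Section transitive_to_wm.
Context (d : measure_display) (X : measurableType d) (R : realType).
Context (mu : probability X R) (T : X -> X).
Hypotheses (mT : measurable_fun setT T)
  (muT : forall A, measurable A -> mu (T @^-1` A) = mu A).
Context (A : set X).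
Hypothesis mA : measurable A.

Let a := fine (mu A).
Let S k := iter k T @^-1` A.
Let corr k l := fine (mu (S k `&` S l)) - a ^+ 2.
Let gram (s t : seq nat) := \sum_(k <- s) \sum_(l <- t) corr k l ^+ 2.
(** The kernel pairing of [kernel_pairing] written on [X]: the last factor is the integral of two
    centered indicators against [rho]. Only values on rectangles occur, whence continuity. *)
Let Phi (s : seq nat) (rho : set (X * X) -> \bar R) :=
  \sum_(k <- s) \sum_(l <- s) corr k l * (fine (rho (S k `*` S l)) - a ^+ 2).
Let shift n (s : seq nat) := [seq (k + n)%N | k <- s].

Lemma measurable_orbit k : measurable (S k).
Proof. exact: measurable_iter_preimage. Qed.

Lemma prob_orbit k : fine (mu (S k)) = a.
Proof. by rewrite prob_iter_preimage. Qed.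

Lemma orbit_shift k n : S (k + n) = iter n T @^-1` S k.
Proof. by apply/seteqP; split => x; rewrite /S /= iterD. Qed.

Lemma corr_shift k l n : corr (k + n) (l + n) = corr k l.
Proof.
rewrite /corr !orbit_shift -preimage_setI prob_iter_preimage //.
by apply: measurableI; exact: measurable_orbit.
Qed.

Lemma corrC k l : corr k l = corr l k.
Proof. by rewrite /corr setIC. Qed.

Lemma corr_norm_le1 k l : `|corr k l| <= 1.
Proof.
have mI : measurable (S k `&` S l) by apply: measurableI; exact: measurable_orbit.
have := probf_ge0 mu (S k `&` S l); have := probf_le1 mu mI.
have := probf_ge0 mu A; have := probf_le1 mu mA.
rewrite -/a /corr ler_norml => *; apply/andP; split; nra.
Qed.

Lemma gram_shift n s : gram (shift n s) (shift n s) = gram s s.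
Proof.
rewrite /gram big_map; apply: eq_bigr => k _; rewrite big_map.
by apply: eq_bigr => l _; rewrite corr_shift.
Qed.

Lemma gramC s t : gram s t = gram t s.
Proof.
rewrite /gram exchange_big; apply: eq_bigr => k _; apply: eq_bigr => l _.
by rewrite corrC.
Qed.

Lemma gram_cat s t :
  gram (s ++ t) (s ++ t) = gram s s + 2 * gram s t + gram t t.
Proof.
have -> : gram (s ++ t) (s ++ t) = gram s s + gram s t + (gram t s + gram t t).
  rewrite /gram big_cat /= -!big_split /=.
  by congr (_ + _); apply: eq_bigr => k _; rewrite big_cat.
rewrite [gram t s]gramC; ring.
Qed.

Lemma gram_ge0 s : 0 <= gram s s.
Proof. by apply: sumr_ge0 => k _; apply: sumr_ge0 => l _; exact: sqr_ge0. Qed.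

(** The lens shifts the sets in the rectangles, and [corr] is unchanged by a common shift, so moving
    the coupling amounts to shifting the list. *)
Lemma Phi_iter_lens n s z : Phi s (iter n (lens T) z) = Phi (shift n s) z.
Proof.
rewrite /Phi big_map; apply: eq_bigr => k _; rewrite big_map.
by apply: eq_bigr => l _; rewrite corr_shift iter_lens_rect !orbit_shift.
Qed.

(** By computation: the diagonal preimage of the rectangle with sides [S k] and [S l] unfolds to
    their intersection. *)
Lemma Phi_diag s : Phi s (fun E => mu ((fun x => (x, x)) @^-1` E)) = gram s s.
Proof. by []. Qed.

Lemma Phi_prod s : Phi s (mu \x mu)%E = 0.
Proof.
rewrite /Phi big1 // => k _; rewrite big1 // => l _.
rewrite prod_rectE; [|exact: measurable_orbit|exact: measurable_orbit].
rewrite fineM; [|by apply: fin_num_measure; exact: measurable_orbit..].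
by rewrite !prob_orbit -expr2 subrr mulr0.
Qed.

(** This is [kernel_pairing_diff] on the partition generated by all [S k] with [k] below [M], a
    bound exceeding every time in [s] and [t]. *)
Lemma Phi_diff s t z : is_coupling mu z ->
  Phi s z - Phi t z <=
  4 * (gram s s - 2 * gram s t + gram t t) + (gram s s + gram t t) / 8.
Proof.
move=> cz.
pose M := (\max_(k <- s ++ t) k).+1.
have sM k : k \in s -> (k < M)%N.
  by move=> ks; rewrite ltnS; apply: leq_bigmax_seq => //; rewrite mem_cat ks.
have tM k : k \in t -> (k < M)%N.
  by move=> ks; rewrite ltnS; apply: leq_bigmax_seq => //; rewrite mem_cat ks orbT.
pose fib (u : M.-tuple bool) := itinerary S M @^-1` [set u].
have mfib u : measurable (fib u) by apply: measurable_itinerary; exact: measurable_orbit.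
pose m u := fine (mu (fib u)).
pose f k (u : M.-tuple bool) : R := (nth false u k)%:R - a.
pose r u v := fine (z (fib u `*` fib v)).
have innerE k l : (k < M)%N -> (l < M)%N ->
    \sum_u m u * (f k u * f l u) = corr k l.
  move=> kM lM; rewrite (centered_probI mu measurable_orbit) // !prob_orbit /corr; ring.
have rE k l : (k < M)%N -> (l < M)%N ->
    \sum_u \sum_v r u v * (f k u * f l v) = fine (z (S k `*` S l)) - a ^+ 2.
  move=> kM lM; rewrite (centered_coupling measurable_orbit _ _ cz) // !prob_orbit; ring.
have gramE p q : (forall k, k \in p -> (k < M)%N) ->
    (forall k, k \in q -> (k < M)%N) ->
    \sum_(k <- p) \sum_(l <- q) (\sum_u m u * (f k u * f l u)) ^+ 2 = gram p q.
  move=> pM qM; apply: eq_big_seq => k kp; apply: eq_big_seq => l lq.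
  by rewrite innerE; [|exact: pM|exact: qM].
have PhiE p : (forall k, k \in p -> (k < M)%N) ->
    \sum_(k <- p) \sum_(l <- p) (\sum_u m u * (f k u * f l u)) *
      (\sum_u \sum_v r u v * (f k u * f l v)) = Phi p z.
  move=> pM; apply: eq_big_seq => k kp; apply: eq_big_seq => l lq.
  by rewrite innerE ?rE ?pM.
rewrite -!PhiE // -!gramE //; apply: kernel_pairing_diff.
- by move=> u; exact: probf_ge0.
- by move=> u v; apply: (coupling_ge0 cz); exact: measurableX.
- by move=> u; exact: (coupling_rows mfib u cz).
- by move=> u; exact: (coupling_cols mfib u cz).
Qed.

Lemma gram_bessel (B : set X) s : measurable B ->
  (\sum_(k <- s) (fine (mu (S k `&` B)) - a * fine (mu B)) ^+ 2) ^+ 2 <=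
  gram s s.
Proof.
move=> mB.
pose N := (\max_(k <- s) k).+1.
have sN k : k \in s -> (k < N)%N.
  by move=> ks; rewrite ltnS; exact: leq_bigmax_seq.
(* [B] is adjoined to the orbit as the set of index [N], so that one partition resolves both. *)
pose E k := if (k < N)%N then S k else B.
have mE k : measurable (E k) by rewrite /E; case: ifP => // _; exact: measurable_orbit.
have ES k : (k < N)%N -> E k = S k by rewrite /E => ->.
have EB : E N = B by rewrite /E ltnn.
pose fib (u : N.+1.-tuple bool) := itinerary E N.+1 @^-1` [set u].
pose m u := fine (mu (fib u)).
pose f k (u : N.+1.-tuple bool) : R := (nth false u k)%:R - a.
pose g (u : N.+1.-tuple bool) : R := (nth false u N)%:R - 0.
have innerE k l : (k < N)%N -> (l < N)%N ->
    \sum_u m u * (f k u * f l u) = corr k l.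
  move=> kN lN; rewrite (centered_probI mu mE) ?(leqW kN) ?(leqW lN) //.
  by rewrite !ES // !prob_orbit /corr; ring.
have gE k : (k < N)%N -> \sum_u m u * (f k u * g u) =
    fine (mu (S k `&` B)) - a * fine (mu B).
  move=> kN; rewrite (centered_probI mu mE) ?(leqW kN) ?ltnSn //.
  by rewrite ES // EB; ring.
have -> : gram s s =
    \sum_(k <- s) \sum_(l <- s) (\sum_u m u * (f k u * f l u)) ^+ 2.
  apply: eq_big_seq => k ks; apply: eq_big_seq => l ls.
  by rewrite innerE ?sN.
rewrite (eq_big_seq (fun k => (\sum_u m u * (f k u * g u)) ^+ 2)); last first.
  by move=> k ks; rewrite gE ?sN.
apply: kernel_bessel.
- by move=> u; exact: probf_ge0.
- exact: itinerary_sum1.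
- by move=> u; rewrite /g subr0; case: nth; rewrite ?lexx ?ler01.
Qed.

Let rects (s : seq nat) := [seq (S k, S l) | k <- s, l <- s].

(** There are [size s] squared terms, with coefficients [corr k l] of absolute value at most [1]. *)
Lemma Phi_close s z r dl : rect_nbhd r (rects s) dl z ->
  `|Phi s z - Phi s r| <= (size s)%:R ^+ 2 * dl.
Proof.
move=> zr; rewrite /Phi -sumrB.
have constE (x : R) : \sum_(k <- s) x = (size s)%:R * x.
  by rewrite big_const_seq count_predT iter_addr_0 mulr_natl.
apply: le_trans (ler_norm_sum _ _ _) _.
rewrite expr2 -mulrA -constE big_seq [leRHS]big_seq; apply: ler_sum => k ks.
rewrite -sumrB; apply: le_trans (ler_norm_sum _ _ _) _.
rewrite -constE big_seq [leRHS]big_seq; apply: ler_sum => l ls.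
rewrite -mulrBr normrM -[leRHS]mul1r; apply: ler_pM => //.
  exact: corr_norm_le1.
rewrite opprB addrA subrK ltW //.
by apply: (zr (S k, S l)); apply: allpairs_f.
Qed.

Lemma transitive_gram_small (eta : R) :
  top_transitive (C2_open mu) (lens T) -> 0 < eta ->
  exists2 s : seq nat, s != [::] & gram s s < (size s)%:R ^+ 2 * eta.
Proof.
move=> tt eta0.
have sz0 s : s != [::] -> 0 < (size s)%:R ^+ 2 :> R.
  by move=> s0; rewrite exprn_gt0 // ltr0n lt0n; apply: contra s0 => /nilP ->.
pose Q := [set x : R | exists2 s : seq nat, s != [::] &
  x = gram s s / (size s)%:R ^+ 2].
have Q0 : lbound Q 0.
  by move=> _ [s s0 ->]; rewrite divr_ge0 ?gram_ge0 ?sqr_ge0.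
have hQ : has_inf Q.
  by split; [exists (gram [:: 0%N] [:: 0%N] / (1%:R) ^+ 2); exists [:: 0%N]|exists 0].
have infP s : s != [::] -> (size s)%:R ^+ 2 * inf Q <= gram s s.
  move=> s0; rewrite mulrC -ler_pdivlMr ?sz0 //.
  by apply: ge_inf; [exact: hQ.2|exists s].
have near_inf e : 0 < e -> exists2 s : seq nat, s != [::] &
    gram s s < (size s)%:R ^+ 2 * (inf Q + e).
  move=> e0; have [_ [s s0 ->]] := inf_adherent e0 hQ.
  by rewrite ltr_pdivrMr ?sz0 // mulrC; exists s.
(* If the infimum is not positive, an almost minimal list is already the one sought; otherwise
   transitivity is contradicted. *)
have [l0|l0] := leP (inf Q) 0.
  have [s s0 sP] := near_inf _ eta0; exists s => //.
  by apply: lt_le_trans sP _; rewrite ler_pM2l ?sz0 // gerDr.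
exfalso; set l := inf Q in infP near_inf l0.
have [|s s0 sP] := near_inf (l / 100); first by rewrite divr_gt0.
set q := (size s)%:R ^+ 2 in sP.
have q0 : 0 < q by exact: sz0.
pose W r := C2 mu `&` rect_nbhd r (rects s) (l / 4).
have oW r : C2_open mu (W r).
  apply: rect_nbhd_open => AB /allpairsP[[k k'] [_ _ ->]].
  by split; exact: measurable_orbit.
have nW r : is_coupling mu r -> W r !=set0.
  by move=> cr; exists r; split => // AB _; rewrite subrr normr0 divr_gt0.
(* A coupling [z] near the diagonal whose image at time [n] is near the product. *)
have [n [z [cz zV] [_ zU]]] :=
  tt _ _ (oW _) (oW _) (nW _ (prod_coupling mu)) (nW _ (diag_coupling mu)).
have := Phi_close zV; have := Phi_close zU.
rewrite Phi_iter_lens Phi_prod Phi_diag -/q !ler_norml.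
move=> /andP[_ h1] /andP[h2 _].
have := Phi_diff s (shift n s) cz; rewrite gram_shift => h3.
have s2 : s ++ shift n s != [::] by case: (s) s0.
(* The concatenation has twice the length, so [4 * q * l] bounds its [gram] from below. Hence the
   squared distance between the kernels of [s] and [shift n s] is below [q * l / 25], whatever [n]
   is. *)
have := infP _ s2; rewrite gram_cat gram_shift size_cat size_map addnn -mul2n.
rewrite natrM exprMn -/q => h4.
have h5 := infP _ s0; rewrite -/q in h5.
have ql : 0 < q * l by exact: mulr_gt0.
rewrite mulrDr in sP.
have e1 : q * (l / 100) = q * l / 100 by rewrite mulrA.
have e2 : q * (l / 4) = q * l / 4 by rewrite mulrA.
rewrite e1 in sP; rewrite e2 in h1 h2.
rewrite -mulrA expr2 in h4.
(* In units of [q * l], the two values of [Phi] differ by at least [3/4 - 1/4 = 1/2], whereas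
   [Phi_diff] allows less than [4/25 + 101/400]. *)
move: (gram s s) (gram s (shift n s)) (Phi s z) (Phi (shift n s) z) (q * l)
  ql sP h1 h2 h3 h4 h5 => *; lra.
Qed.

Lemma transitive_cesaro (B : set X) :
  top_transitive (C2_open mu) (lens T) -> measurable B ->
  ((fun N : nat => N.+1%:R^-1 * \sum_(n < N.+1)
      `|fine (mu (iter n T @^-1` A `&` B)) - fine (mu A) * fine (mu B)|) : R^nat)
    @ \oo --> (0 : R).
Proof.
move=> tt mB.
apply: (cesaro_of_shifts (x := fun n => fine (mu (S n `&` B)) - a * fine (mu B))).
  move=> n; have mI : measurable (S n `&` B) by apply: measurableI => //; exact: measurable_orbit.
  have := probf_ge0 mu (S n `&` B); have := probf_le1 mu mI.
  have := probf_ge0 mu A; have := probf_le1 mu mA.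
  have := probf_ge0 mu B; have := probf_le1 mu mB.
  rewrite -/a ler_norml => *; apply/andP; split; nra.
move=> eta eta0.
(* The square of [eta] is taken because [gram_bessel] bounds the square of the sum; [gram_shift]
   makes the bound uniform in [n]. *)
have [s s0 sP] := transitive_gram_small tt (exprn_gt0 2 eta0).
exists s => // n.
have := gram_bessel (shift n s) mB; rewrite gram_shift big_map => h.
have := le_lt_trans h sP; rewrite -exprMn.
rewrite ltr_pXn2r // ?nnegrE; first exact: ltW.
- by apply: sumr_ge0 => k _; exact: sqr_ge0.
- by rewrite mulr_ge0 // ltW.
Qed.

End transitive_to_wm.

Theorem mainTheorem7 (d : measure_display) (X : measurableType d) (R : realType)
  (mu : probability X R) (T : X -> X) :
  standard_borel X R -> is_aut mu T -> ergodic mu T ->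
  (weakly_mixing mu T <-> top_transitive (C2_open mu) (lens T)) /\
  (top_transitive (C2_open mu) (lens T) <-> top_weakly_mixing (C2_open mu) (lens T)).
Proof.
move=> _ [_ [_ _ mT _ muT]] _.
have wm_twm := wm_top_weakly_mixing mT muT.
have tt_wm : top_transitive (C2_open mu) (lens T) -> weakly_mixing mu T.
  by move=> tt A B mA mB; exact: transitive_cesaro.
have twm_tt := @twm_transitive _ (C2_open mu) (lens T).
split; split => //.
- by move=> /wm_twm /twm_tt.
- by move=> /tt_wm /wm_twm.
Qed.
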